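(* Let $\Phi:\mathbb{M}_n^k\to\mathbb{M}_m$ be a positive multilinear mapping and let $f_1,\dots,f_k$ be operator log-convex functions. Let $F(A_1,\dots,A_k)=\Phi(f_1(A_1),\dots,f_k(A_k))$ for positive definite $A_1,\dots,A_k\in\mathbb{M}_n$. (i) $F$ is jointly log-convex: $F(A_1\nabla B_1,\dots,A_k\nabla B_k)\le F(A_1,\dots,A_k)\,\sharp\,F(B_1,\dots,B_k)$ for all positive definite $A_i,B_i$. (ii) $(A_1,\dots,A_k)\mapsto F(A_1,\dots,A_k)^{-1}$ is jointly log-concave: $F(A_1\nabla B_1,\dots,A_k\nabla B_k)^{-1}\ge F(A_1,\dots,A_k)^{-1}\,\sharp\,F(B_1,\dots,B_k)^{-1}$. (iii) For every convex monotone increasing function $h$, the map $(A_1,\dots,A_k)\mapsto\mathrm{Tr}\{h(\Phi(f_1(A_1),\dots,f_k(A_k)))\}$ is jointly convex.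
   Context: $\mathbb{M}_n$ denotes $n\times n$ complex matrices, $\mathrm{Tr}$ the trace, $\le$ the Löwner order. $\Phi:\mathbb{M}_n^k\to\mathbb{M}_m$ is multilinear if linear in each variable, and positive if $\Phi(A_1,\dots,A_k)$ is positive semidefinite whenever all $A_i$ are. $X\nabla Y=(X+Y)/2$, $X\sharp Y=X^{1/2}(X^{-1/2}YX^{-1/2})^{1/2}X^{1/2}$. The functions $f_i$ are nonnegative continuous on $(0,\infty)$, and $f$ is operator log-convex if $f(X\nabla Y)\le f(X)\sharp f(Y)$ for all positive definite $X,Y$. Jointly convex means $T((1-\lambda)A+\lambda B)\le(1-\lambda)T(A)+\lambda T(B)$ for tuples $A,B$ and $\lambda\in[0,1]$ (operations componentwise).
   Formalization: Parts (i) and (ii) are stated when the inverses they use exist: F(A) invertible in (i); F(A), F(B) and F at the midpoint invertible in (ii). A merely positive mapping, e.g. A ↦ A⊕0, can make F singular, and then the formula for ♯ and the inverses are undefined. *)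

(* Defs.v *)
From mathcomp Require Import all_boot all_algebra.
From mathcomp Require Import complex spectral.
From mathcomp Require Import reals topology normedtype.
Import GRing.Theory Num.Theory numFieldNormedType.Exports.

Set Implicit Arguments.
Unset Strict Implicit.
Unset Printing Implicit Defensive.

Local Open Scope ring_scope.

Section MatrixAnalysis.
Variable R : realType.
Local Notation C := (R[i]).

Definition adjmx p q (A : 'M[C]_(p, q)) : 'M[C]_(q, p) := map_mx Num.conj A^T.

Definition psdmx p (A : 'M[C]_p) : Prop :=
  forall v : 'rV[C]_p, 0 <= (v *m A *m adjmx v) 0 0.

Definition pdmx p (A : 'M[C]_p) : Prop :=
  forall v : 'rV[C]_p, v != 0 -> 0 < (v *m A *m adjmx v) 0 0.

Definition loewner p (A B : 'M[C]_p) : Prop := psdmx (B - A).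

(* Functional calculus for Hermitian matrices, via the spectral decomposition
   A = P^{-1} diag(d) P (P unitary, d real):  f(A) = P^{-1} diag(f(d)) P. *)
Definition mxfun p (f : R -> R) (A : 'M[C]_p) : 'M[C]_p :=
  invmx (spectralmx A)
  *m diag_mx (map_mx (fun z : C => ((f (complex.Re z))%:C)%C) (spectral_diag A))
  *m spectralmx A.

Definition sqrtm p (A : 'M[C]_p) : 'M[C]_p := mxfun (@Num.sqrt R) A.

Definition amean p (X Y : 'M[C]_p) : 'M[C]_p := 2^-1 *: (X + Y).

Definition gmean p (X Y : 'M[C]_p) : 'M[C]_p :=
  sqrtm X *m sqrtm (invmx (sqrtm X) *m Y *m invmx (sqrtm X)) *m sqrtm X.

Definition op_log_convex (f : R -> R) : Prop :=
  forall p (X Y : 'M[C]_p), pdmx X -> pdmx Y ->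
    loewner (mxfun f (amean X Y)) (gmean (mxfun f X) (mxfun f Y)).

Definition upd k p (A : 'I_k -> 'M[C]_p) (i : 'I_k) (X : 'M[C]_p) :
  'I_k -> 'M[C]_p := fun j => if j == i then X else A j.

Definition multilinear k n m (Phi : ('I_k -> 'M[C]_n) -> 'M[C]_m) : Prop :=
  forall (A : 'I_k -> 'M[C]_n) (i : 'I_k) (c : C) (X Y : 'M[C]_n),
    Phi (upd A i (c *: X + Y)) = c *: Phi (upd A i X) + Phi (upd A i Y).

Definition positive_map k n m (Phi : ('I_k -> 'M[C]_n) -> 'M[C]_m) : Prop :=
  forall A : 'I_k -> 'M[C]_n, (forall j, psdmx (A j)) -> psdmx (Phi A).

End MatrixAnalysis.

(* Main.v *)
(* Positive definite X and Y are diagonalised by one congruence: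
   X = V^* V, Y = V^* D^2 V and X # Y = V^* D V.  Expanding a positive multilinear
   map Phi slot by slot over the rank-one terms of these decompositions shows that
   the block matrix [[Phi(X), Phi(X # Y)], [Phi(X # Y), Phi(Y)]] is positive
   semidefinite, hence Phi(X # Y) <= Phi(X) # Phi(Y) and
   Phi(X # Y) <= (Phi(X) + Phi(Y)) / 2.  With the monotonicity of Phi the first
   bound gives (i), and (ii) follows by inversion.  The second one makes F
   midpoint convex; it is bounded on segments, hence convex there, and (iii)
   follows from Jensen's inequality in an eigenbasis of the value of F at the
   intermediate point.  An operator log-convex f is either identically zero or
   strictly positive on (0, oo), so the junk value of [gmean] at singular matrices
   is harmless. *)
Require Import Defs.
From mathcomp Require Import all_boot all_order all_algebra.
From mathcomp Require Import complex spectral.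
From mathcomp Require Import boolp classical_sets reals topology normedtype.
From mathcomp Require Import derive.
From mathcomp Require Import ring lra.
Import Order.TTheory GRing.Theory Num.Theory numFieldNormedType.Exports.

Set Implicit Arguments.
Unset Strict Implicit.
Unset Printing Implicit Defensive.

Local Open Scope ring_scope.

(** * Adjoints, sesquilinear forms and the Loewner order *)

Section Adjoint.
Variable R : realType.
Local Notation C := (R[i]).

Lemma adjmxK p q (A : 'M[C]_(p, q)) : adjmx (adjmx A) = A.
Proof. exact: trmxCK. Qed.

Lemma adjmxM p q r (A : 'M[C]_(p, q)) (B : 'M[C]_(q, r)) :
  adjmx (A *m B) = adjmx B *m adjmx A.
Proof. by rewrite /adjmx trmx_mul map_mxM. Qed.

Lemma adjmxD p q (A B : 'M[C]_(p, q)) : adjmx (A + B) = adjmx A + adjmx B.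
Proof. by rewrite /adjmx linearD map_mxD. Qed.

Lemma adjmxN p q (A : 'M[C]_(p, q)) : adjmx (- A) = - adjmx A.
Proof. by rewrite /adjmx linearN map_mxN. Qed.

Lemma adjmxZ p q c (A : 'M[C]_(p, q)) : adjmx (c *: A) = c^* *: adjmx A.
Proof. by rewrite /adjmx linearZ map_mxZ. Qed.

Lemma adjmx1 p : adjmx 1%:M = 1%:M :> 'M[C]_p.
Proof. by rewrite /adjmx trmx1 map_mx1. Qed.

Lemma adjmx_delta p q (i : 'I_p) (j : 'I_q) :
  adjmx (delta_mx i j : 'M[C]_(p, q)) = delta_mx j i.
Proof. by rewrite /adjmx trmx_delta map_delta_mx. Qed.

Lemma conj_realC (x : R) : Num.conj (x%:C)%C = (x%:C)%C.
Proof. exact: conjc_real. Qed.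

Lemma Re_ge0 (z : C) : 0 <= z -> 0 <= complex.Re z.
Proof. by rewrite lecE => /andP[]. Qed.

Lemma ReD (x y : C) : complex.Re (x + y) = complex.Re x + complex.Re y.
Proof. by case: x y => [? ?] []. Qed.

Lemma ReN (x : C) : complex.Re (- x) = - complex.Re x.
Proof. by case: x. Qed.

Lemma ReC (x : R) : complex.Re (x%:C)%C = x. Proof. by []. Qed.

Lemma ReK (z : C) : Num.conj z = z -> z = ((complex.Re z)%:C)%C.
Proof.
case: z => a b [] e; apply/eqP; rewrite eq_complex /= eqxx /=.
by move: e => /eqP; rewrite eq_sym -addr_eq0 -mulr2n mulrn_eq0.
Qed.

(** [psdmx] and [pdmx] are conditions on the diagonal of this form; naming it allows calculation by
    sesquilinearity. *)
Definition qf p (A : 'M[C]_p) (u v : 'rV[C]_p) : C := (u *m A *m adjmx v) 0 0.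

Section QForm.
Variable p : nat.
Implicit Types (A B : 'M[C]_p) (u v w : 'rV[C]_p).

Lemma qfDm A B u v : qf (A + B) u v = qf A u v + qf B u v.
Proof. by rewrite /qf mulmxDr mulmxDl mxE. Qed.
Lemma qfNm A u v : qf (- A) u v = - qf A u v.
Proof. by rewrite /qf mulmxN mulNmx mxE. Qed.
Lemma qfZm c A u v : qf (c *: A) u v = c * qf A u v.
Proof. by rewrite /qf -scalemxAr -scalemxAl mxE. Qed.
Lemma qfDl A u w v : qf A (u + w) v = qf A u v + qf A w v.
Proof. by rewrite /qf !mulmxDl mxE. Qed.
Lemma qfDr A u v w : qf A u (v + w) = qf A u v + qf A u w.
Proof. by rewrite /qf adjmxD mulmxDr mxE. Qed.
Lemma qfNl A u v : qf A (- u) v = - qf A u v.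
Proof. by rewrite /qf !mulNmx mxE. Qed.
Lemma qfNr A u v : qf A u (- v) = - qf A u v.
Proof. by rewrite /qf adjmxN mulmxN mxE. Qed.
Lemma qfZl A c u v : qf A (c *: u) v = c * qf A u v.
Proof. by rewrite /qf -!scalemxAl mxE. Qed.
Lemma qfZr A c u v : qf A u (c *: v) = c^* * qf A u v.
Proof. by rewrite /qf adjmxZ -scalemxAr mxE. Qed.
Lemma qf_adj A u v : qf (adjmx A) u v = Num.conj (qf A v u).
Proof.
have -> : Num.conj (qf A v u) = adjmx (v *m A *m adjmx u) 0 0.
  by rewrite /adjmx [in RHS]mxE [in RHS]mxE.
by rewrite !adjmxM adjmxK mulmxA.
Qed.
Lemma qf_mulr A B u v : qf A u (v *m B) = qf (A *m adjmx B) u v.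
Proof. by rewrite /qf adjmxM !mulmxA. Qed.
Lemma qf_mull A B u v : qf A (u *m B) v = qf (B *m A) u v.
Proof. by rewrite /qf !mulmxA. Qed.
End QForm.

Lemma qf_congr p q (A : 'M[C]_p) (B : 'M[C]_(q, p)) u v :
  qf (B *m A *m adjmx B) u v = qf A (u *m B) (v *m B).
Proof. by rewrite /qf adjmxM !mulmxA. Qed.

Lemma qf_delta p (A : 'M[C]_p) i j :
  qf A (delta_mx 0 i) (delta_mx 0 j) = A i j.
Proof.
by rewrite /qf adjmx_delta -rowE -colE !mxE.
Qed.

(* Polarisation, with [u + w] and [i u + w]. *)
Lemma qf_eq0 p (A : 'M[C]_p) : (forall v, qf A v v = 0) -> A = 0.
Proof.
move=> A0.
have skew u w : qf A u w + qf A w u = 0.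
  by have := A0 (u + w); rewrite !(qfDl, qfDr) !A0 addr0 add0r.
suff z u w : qf A u w = 0 by apply/matrixP => i j; rewrite -qf_delta z mxE.
have /eqP := skew ('i%C *: u) w; rewrite qfZl qfZr.
have -> : Num.conj 'i%C = - 'i%C :> C.
  by apply/eqP; rewrite eq_complex /= oppr0 !eqxx.
rewrite mulNr -mulrBr mulf_eq0.
have -> /= : ('i%C == 0 :> C) = false by rewrite eq_complex /= oner_eq0 andbF.
move=> /eqP h; have := skew u w.
move/eqP: h; rewrite subr_eq0 => /eqP <- /eqP.
by rewrite -mulr2n mulrn_eq0 => /eqP.
Qed.

(** An inequality [0 <= z] in [C] forces [z] to be real, so the form of $A^*-A$ vanishes on the
    diagonal. *)
Lemma psdmx_adj p (A : 'M[C]_p) : psdmx A -> adjmx A = A.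
Proof.
move=> Apsd; apply/eqP; rewrite -subr_eq0; apply/eqP/qf_eq0 => v.
rewrite qfDm qfNm qf_adj; apply/eqP; rewrite subr_eq0; apply/eqP.
by apply/CrealP/ger0_real/Apsd.
Qed.

Lemma qf_real p (A : 'M[C]_p) v :
  adjmx A = A -> qf A v v = ((complex.Re (qf A v v))%:C)%C.
Proof. by move=> hA; apply: ReK; rewrite -qf_adj hA. Qed.

Lemma herm_psdmx p (A : 'M[C]_p) : adjmx A = A ->
  (forall v, 0 <= complex.Re (qf A v v)) -> psdmx A.
Proof. by move=> hA A0 v; rewrite -/(qf A v v) qf_real // ler0c. Qed.

Lemma psdmx_Re p (A : 'M[C]_p) v : psdmx A -> 0 <= complex.Re (qf A v v).
Proof. by move=> /(_ v)/Re_ge0. Qed.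

Lemma psdmx0 p : psdmx (0 : 'M[C]_p).
Proof. by move=> v; rewrite mulmx0 mul0mx mxE. Qed.

Lemma psdmxD p (A B : 'M[C]_p) : psdmx A -> psdmx B -> psdmx (A + B).
Proof.
move=> hA hB v; rewrite -/(qf _ _ _) qfDm addr_ge0 //; first exact: hA.
exact: hB.
Qed.

Lemma psdmxZ p (c : R) (A : 'M[C]_p) : 0 <= c -> psdmx A -> psdmx ((c%:C)%C *: A).
Proof.
move=> c0 hA v; rewrite -/(qf _ _ _) qfZm mulr_ge0 ?ler0c //.
exact: hA.
Qed.

Lemma psdmx_sum p I (r : seq I) (P : pred I) (A : I -> 'M[C]_p) :
  (forall i, P i -> psdmx (A i)) -> psdmx (\sum_(i <- r | P i) A i).
Proof. by apply: big_ind; [exact: psdmx0|move=> ? ?; exact: psdmxD]. Qed.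

Lemma psdmx_congr p q (A : 'M[C]_p) (B : 'M[C]_(q, p)) :
  psdmx A -> psdmx (B *m A *m adjmx B).
Proof. by move=> hA v; rewrite -/(qf _ _ _) qf_congr; apply: hA. Qed.

Lemma psdmx1 p : psdmx (1%:M : 'M[C]_p).
Proof.
move=> v; rewrite mulmx1 !mxE sumr_ge0 // => i _.
by rewrite !mxE mul_conjC_ge0.
Qed.

Lemma pdmx_psdmx p (A : 'M[C]_p) : pdmx A -> psdmx A.
Proof.
move=> hA v; have [->|/hA/ltW//] := eqVneq v 0.
by rewrite !mul0mx mxE.
Qed.

Lemma pdmxD p (A B : 'M[C]_p) : pdmx A -> psdmx B -> pdmx (A + B).
Proof.
move=> hA hB v v0; rewrite -/(qf _ _ _) qfDm ltr_wpDr //; last exact: hA.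
exact: hB.
Qed.

Lemma pdmx_unit p (A : 'M[C]_p) : pdmx A -> A \in unitmx.
Proof.
move=> hA; rewrite -row_free_unit -kermx_eq0; apply/eqP/row_matrixP => i.
rewrite row0; apply/eqP/negPn/negP => /hA.
have -> : row i (kermx A) *m A = 0 by rewrite -row_mul mulmx_ker row0.
by rewrite mul0mx mxE ltxx.
Qed.

Lemma pdmx_congr p (A B : 'M[C]_p) :
  B \in unitmx -> pdmx A -> pdmx (B *m A *m adjmx B).
Proof.
move=> uB hA v v0; rewrite -/(qf _ _ _) qf_congr; apply: hA.
by apply: contraNneq v0 => e; rewrite -(mulmxK uB v) e mul0mx.
Qed.

Lemma loewnerxx p (A : 'M[C]_p) : loewner A A.
Proof. by rewrite /loewner subrr; exact: psdmx0. Qed.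

Lemma loewner_trans p (B A D : 'M[C]_p) :
  loewner A B -> loewner B D -> loewner A D.
Proof. by rewrite /loewner => h1 h2; have := psdmxD h2 h1; rewrite subrKA. Qed.

End Adjoint.

(** * Spectral decomposition and functional calculus *)

Section Spectral.
Variable R : realType.
Local Notation C := (R[i]).

(** Unitary [V] gives spectral decompositions, general [V] the simultaneous diagonalisation of two
    matrices by congruence. *)
Definition congdiag p q (V : 'M[C]_(q, p)) (d : 'I_q -> R) : 'M[C]_p :=
  adjmx V *m diag_mx (\row_i ((d i)%:C)%C) *m V.

Lemma qf1 p (v : 'rV[C]_p) : qf 1%:M v v = \sum_i `|v 0 i| ^+ 2.
Proof.
rewrite /qf mulmx1 mxE; apply: eq_bigr => i _.
by rewrite /adjmx !mxE normCK.
Qed.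

Lemma diag_realC_adj q (d : 'I_q -> R) :
  adjmx (diag_mx (\row_i ((d i)%:C)%C)) = diag_mx (\row_i ((d i)%:C)%C).
Proof.
rewrite /adjmx tr_diag_mx map_diag_mx; congr diag_mx.
by apply/rowP => i; rewrite !mxE; exact: conj_realC.
Qed.

Lemma congdiag_adj p q (V : 'M[C]_(q, p)) d : adjmx (congdiag V d) = congdiag V d.
Proof. by rewrite /congdiag !adjmxM adjmxK diag_realC_adj mulmxA. Qed.

Lemma congdiagE p q (V : 'M[C]_(q, p)) d :
  congdiag V d = \sum_i ((d i)%:C)%C *: (adjmx (row i V) *m row i V).
Proof.
apply/matrixP => a b; rewrite summxE mxE; apply: eq_bigr => i _.
rewrite mul_mx_diag /adjmx !mxE big_ord1 !mxE.
by rewrite mulrA [_ * (d i)%:C%C]mulrC.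
Qed.

Lemma psdmx_rank1 p (v : 'rV[C]_p) : psdmx (adjmx v *m v).
Proof.
have := psdmx_congr (adjmx v) (@psdmx1 R 1).
by rewrite mulmx1 adjmxK.
Qed.

Lemma psdmx_congdiag p q (V : 'M[C]_(q, p)) d :
  (forall i, 0 <= d i) -> psdmx (congdiag V d).
Proof.
move=> d0; rewrite congdiagE; apply: psdmx_sum => i _.
by apply: psdmxZ (d0 i) _; apply: psdmx_rank1.
Qed.

Lemma qf_congdiag p q (V : 'M[C]_(q, p)) d v :
  qf (congdiag V d) v v = \sum_i ((d i)%:C)%C * `|(v *m adjmx V) 0 i| ^+ 2.
Proof.
rewrite /congdiag -{2}[V]adjmxK qf_congr; set x := v *m _.
rewrite /qf mxE; apply: eq_bigr => i _.
by rewrite mul_mx_diag /adjmx [X in X * _]mxE !mxE normCK; ring.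
Qed.

Section Unitary.
Variable p : nat.
Implicit Types (U A : 'M[C]_p) (d e : 'I_p -> R).

Lemma mulmx1_unitl A (B : 'M[C]_p) : A *m B = 1%:M -> A \in unitmx.
Proof. by case/mulmx1_unit. Qed.

Definition unitary U : Prop := U *m adjmx U = 1%:M.

Lemma unitary_adjr U : unitary U -> U *m adjmx U = 1%:M.
Proof. by []. Qed.

Lemma unitary_adjl U : unitary U -> adjmx U *m U = 1%:M.
Proof. exact: mulmx1C. Qed.

Lemma unitary_unit U : unitary U -> U \in unitmx.
Proof. exact: mulmx1_unitl. Qed.

Lemma spectralmx_unitary A : unitary (spectralmx A).
Proof. exact/unitarymxP/spectral_unitarymx. Qed.

Lemma invmx_spectralmx A : invmx (spectralmx A) = adjmx (spectralmx A).
Proof. exact: invmx_unitary (spectral_unitarymx A). Qed.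

Lemma spectral_decomp A : adjmx A = A ->
  exists U d, unitary U /\ A = congdiag U d.
Proof.
move=> hA; exists (spectralmx A), (fun i => complex.Re (spectral_diag A 0 i)).
split; first exact: spectralmx_unitary.
have hermA : A \is hermsymmx.
  by apply/is_hermitianmxP; rewrite expr0 scale1r; exact/esym.
rewrite [LHS](orthomx_spectralP (hermitian_normalmx hermA)).
rewrite invmx_spectralmx /congdiag.
congr (_ *m diag_mx _ *m _); apply/rowP => i; rewrite !mxE.
apply/ReK/CrealP.
by have /mxOverP := hermitian_spectral_diag_real hermA; apply.
Qed.

Lemma congdiagM U d e : unitary U ->
  congdiag U d *m congdiag U e = congdiag U (fun i => d i * e i).
Proof.
move=> uU; rewrite /congdiag !mulmxA.
rewrite -(mulmxA _ U) unitary_adjr // mulmx1.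
rewrite -[_ *m diag_mx _ *m diag_mx _]mulmxA mulmx_diag.
by congr (_ *m diag_mx _ *m _); apply/rowP => i; rewrite !mxE rmorphM.
Qed.

Lemma congdiag1 p' (V : 'M[C]_(p', p)) : congdiag V (fun=> 1) = adjmx V *m V.
Proof.
rewrite /congdiag (_ : diag_mx _ = 1%:M) ?mulmx1 //.
by apply/matrixP => i j; rewrite !mxE.
Qed.

Lemma row_unitary U i : unitary U -> qf 1%:M (row i U) (row i U) = 1.
Proof.
by move=> uU; rewrite rowE -qf_congr mulmx1 unitary_adjr // qf_delta mxE eqxx.
Qed.

Lemma row_congdiag U d i : unitary U ->
  row i U *m congdiag U d = ((d i)%:C)%C *: row i U.
Proof.
move=> uU; rewrite /congdiag rowE -!mulmxA [U *m _]mulmxA unitary_adjr // mul1mx.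
rewrite mulmxA -rowE; apply/rowP => j; rewrite -!rowE.
rewrite row_diag_mx -scalemxAl -rowE !mxE //.
Qed.

Lemma qf_row_congdiag U d i : unitary U ->
  qf (congdiag U d) (row i U) (row i U) = ((d i)%:C)%C.
Proof.
move=> uU; rewrite /qf row_congdiag // -scalemxAl mxE.
by have := row_unitary i uU; rewrite /qf mulmx1 => ->; rewrite mulr1.
Qed.

Lemma row_unitary_neq0 U i : unitary U -> row i U != 0.
Proof.
move=> uU; apply/eqP => h; have := row_unitary i uU.
by rewrite h /qf !mul0mx mxE => /esym/eqP; rewrite oner_eq0.
Qed.

Lemma congdiag_psdmx_ge0 U d : unitary U -> psdmx (congdiag U d) ->
  forall i, 0 <= d i.
Proof.
by move=> uU h i; rewrite -ler0c -(qf_row_congdiag d i uU); apply: h.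
Qed.

Lemma congdiag_pdmx_gt0 U d : unitary U -> pdmx (congdiag U d) ->
  forall i, 0 < d i.
Proof.
move=> uU h i; rewrite -ltcR -(qf_row_congdiag d i uU); apply: h.
exact: row_unitary_neq0.
Qed.

Lemma pdmx1 : pdmx (1%:M : 'M[C]_p).
Proof.
move=> v v0; rewrite lt_neqAle psdmx1 andbT eq_sym -/(qf _ _ _) qf1.
apply: contraNneq v0 => /eqP; rewrite psumr_eq0 => [/allP h|i _]; last exact: exprn_ge0.
apply/eqP/rowP => i; have := h i (mem_index_enum i).
by rewrite sqrf_eq0 normr_eq0 mxE => /eqP.
Qed.

(** The Hermitian root $S$ inherits invertibility from $A=S^2$, so $A=SS^*$ is congruent to the
    identity. *)
Lemma psdmx_unit_pdmx A : psdmx A -> A \in unitmx -> pdmx A.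
Proof.
move=> hA uA; have [U [d [uU e]]] := spectral_decomp (psdmx_adj hA).
have d0 : forall i, 0 <= d i by apply: congdiag_psdmx_ge0 uU _; rewrite -e.
have sA : congdiag U (fun i => Num.sqrt (d i)) *m congdiag U (fun i => Num.sqrt (d i)) = A.
  rewrite congdiagM // e; congr congdiag; apply: funext => i.
  by rewrite -expr2 sqr_sqrtr.
set S := congdiag _ _ in sA.
have uS : S \in unitmx by move: uA; rewrite -sA unitmx_mul => /andP[].
have := pdmx_congr uS pdmx1; by rewrite mulmx1 congdiag_adj sA.
Qed.

Lemma pdmx_congdiag U d : unitary U -> (forall i, 0 < d i) ->
  pdmx (congdiag U d).
Proof.
move=> uU d0; apply: psdmx_unit_pdmx; first by apply: psdmx_congdiag => i; apply/ltW.
apply: (@mulmx1_unitl _ (congdiag U (fun i => (d i)^-1))).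
rewrite congdiagM // -(unitary_adjl uU) -congdiag1; congr congdiag.
by apply: funext => i; rewrite divff // gt_eqF.
Qed.

(* An intertwiner is supported where the two diagonals agree, so it intertwines
   any function of them; this makes [mxfun] independent of the diagonalisation. *)
Lemma diag_mx_intertwine (g : C -> C) (a b : 'rV[C]_p) (W : 'M[C]_p) :
  diag_mx a *m W = W *m diag_mx b ->
  diag_mx (map_mx g a) *m W = W *m diag_mx (map_mx g b).
Proof.
move=> /matrixP h; apply/matrixP => i j; have := h i j.
rewrite !mul_diag_mx !mul_mx_diag !mxE.
have [->|w0] := eqVneq (W i j) 0; first by rewrite !mulr0 !mul0r.
by rewrite ![W i j * _]mulrC => /(mulIf w0) ->.
Qed.

Lemma mxfun_congdiag f U d : unitary U ->
  mxfun f (congdiag U d) = congdiag U (f \o d).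
Proof.
move=> uU; rewrite /mxfun; set A := congdiag U d.
set V := spectralmx A; set e := spectral_diag A.
have uV : unitary V by exact: spectralmx_unitary.
have Vn : V \in unitmx by exact: unitary_unit.
have Un : U \in unitmx by exact: unitary_unit.
have nA : A \is normalmx.
  by apply/normalmxP; rewrite -/(adjmx A) congdiag_adj.
have eA : A = invmx V *m diag_mx e *m V by apply: orthomx_spectralP.
(* [W] relates the given eigenbasis to the one chosen by [spectralmx] and intertwines the two lists
   of eigenvalues. *)
pose W := V *m adjmx U.
have eW : diag_mx e *m W = W *m diag_mx (\row_i ((d i)%:C)%C).
  have hV : V *m A = diag_mx e *m V by rewrite {1}eA -mulmxA mulKVmx.
  have hU : A *m adjmx U = adjmx U *m diag_mx (\row_i ((d i)%:C)%C).
    by rewrite -(mulmxA _ U) unitary_adjr // mulmx1.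
  by rewrite /W mulmxA -hV -(mulmxA V A) hU mulmxA.
pose g z : C := ((f (complex.Re z))%:C)%C.
have fW : diag_mx (map_mx g e) *m W = W *m diag_mx (\row_i ((f (d i))%:C)%C).
  rewrite (diag_mx_intertwine g eW); congr (_ *m diag_mx _).
  by apply/rowP => i; rewrite !mxE.
rewrite -(mulmxA (invmx V)); apply: (canLR (mulKmx Vn)).
by rewrite /congdiag !mulmxA -/W -fW /W -!mulmxA unitary_adjl // mulmx1.
Qed.

End Unitary.
End Spectral.

(** * Square roots, inverses and geometric means *)

Section Gmean.
Variable R : realType.
Local Notation C := (R[i]).

Section Sqrtm.
Variable p : nat.
Implicit Types (A B X Y : 'M[C]_p).

Lemma psdmx_decomp A : psdmx A ->
  exists U d, [/\ unitary U, forall i, 0 <= d i & A = congdiag U d].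
Proof.
move=> hA; have [U [d [uU e]]] := spectral_decomp (psdmx_adj hA).
by exists U, d; split=> //; apply: congdiag_psdmx_ge0 uU _; rewrite -e.
Qed.

Lemma pdmx_decomp A : pdmx A ->
  exists U d, [/\ unitary U, forall i, 0 < d i & A = congdiag U d].
Proof.
move=> hA; have [U [d [uU e]]] := spectral_decomp (psdmx_adj (pdmx_psdmx hA)).
by exists U, d; split=> //; apply: congdiag_pdmx_gt0 uU _; rewrite -e.
Qed.

Lemma congdiag_inv U (d : 'I_p -> R) : unitary U -> (forall i, d i != 0) ->
  congdiag U d *m congdiag U (fun i => (d i)^-1) = 1%:M.
Proof.
move=> uU d0; rewrite congdiagM // -(unitary_adjl uU) -congdiag1.
by congr congdiag; apply: funext => i; rewrite divff.
Qed.

Lemma mulmx1_invmx A B : A *m B = 1%:M -> invmx A = B.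
Proof.
move=> h; have uA := mulmx1_unitl h.
by rewrite -[RHS](mulKmx uA) h mulmx1.
Qed.

Lemma invmx_congdiag U (d : 'I_p -> R) : unitary U -> (forall i, d i != 0) ->
  invmx (congdiag U d) = congdiag U (fun i => (d i)^-1).
Proof. by move=> uU d0; apply: mulmx1_invmx; apply: congdiag_inv. Qed.

Lemma sqrtm_congdiag U (d : 'I_p -> R) : unitary U ->
  sqrtm (congdiag U d) = congdiag U (fun i => Num.sqrt (d i)).
Proof. exact: mxfun_congdiag. Qed.

Lemma psdmx_sqrtm A : psdmx A -> psdmx (sqrtm A).
Proof.
move=> /psdmx_decomp[U [d [uU d0 ->]]]; rewrite sqrtm_congdiag //.
by apply: psdmx_congdiag => i; apply: sqrtr_ge0.
Qed.

Lemma sqrtmM A : psdmx A -> sqrtm A *m sqrtm A = A.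
Proof.
move=> /psdmx_decomp[U [d [uU d0 ->]]]; rewrite sqrtm_congdiag // congdiagM //.
by congr congdiag; apply: funext => i; rewrite -expr2 sqr_sqrtr.
Qed.

Lemma pdmx_sqrtm A : pdmx A -> pdmx (sqrtm A).
Proof.
move=> /pdmx_decomp[U [d [uU d0 ->]]]; rewrite sqrtm_congdiag //.
by apply: pdmx_congdiag => // i; rewrite sqrtr_gt0.
Qed.

Lemma sqrtm_inv A B : pdmx A -> A *m B = 1%:M -> sqrtm A *m sqrtm B = 1%:M.
Proof.
move=> /pdmx_decomp[U [d [uU d0 ->]]] /mulmx1_invmx <-.
have dn0 i : d i != 0 by rewrite gt_eqF.
rewrite invmx_congdiag // !sqrtm_congdiag // congdiagM //.
rewrite -(unitary_adjl uU) -congdiag1; congr congdiag; apply: funext => i.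
by rewrite sqrtrV ?ltW // divff // gt_eqF // sqrtr_gt0.
Qed.

Lemma psdmx_congr_herm A B : adjmx B = B -> psdmx A -> psdmx (B *m A *m B).
Proof. by move=> hB hA; have := psdmx_congr B hA; rewrite hB. Qed.

Lemma pdmx_congr_herm A B : adjmx B = B -> B \in unitmx -> pdmx A ->
  pdmx (B *m A *m B).
Proof. by move=> hB uB hA; have := pdmx_congr uB hA; rewrite hB. Qed.

Lemma pdmx_inv A : pdmx A ->
  exists B, [/\ A *m B = 1%:M, B *m A = 1%:M & pdmx B].
Proof.
move=> hA; have h : A *m invmx A = 1%:M by apply/mulmxV/pdmx_unit.
exists (invmx A); split; [exact: h|exact: mulmx1C|].
move: hA => /pdmx_decomp[U [d [uU d0 ->]]].
rewrite invmx_congdiag //; first by apply: pdmx_congdiag => // i; rewrite invr_gt0.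
by move=> i; rewrite gt_eqF.
Qed.

Lemma inv_adj A B : adjmx A = A -> A *m B = 1%:M -> adjmx B = B.
Proof.
move=> aA AB; have := congr1 (@adjmx _ _ _) AB; rewrite adjmxM aA adjmx1 => h.
by rewrite -[LHS]mulmx1 -AB mulmxA h mul1mx.
Qed.

Lemma gmeanE X Y T : sqrtm X *m T = 1%:M ->
  gmean X Y = sqrtm X *m sqrtm (T *m Y *m T) *m sqrtm X.
Proof. by move=> /mulmx1_invmx <-. Qed.

Lemma gmean_pdmx X Y : pdmx X -> pdmx Y -> pdmx (gmean X Y).
Proof.
move=> hX hY; have hS := pdmx_sqrtm hX; have [T [ST TS hT]] := pdmx_inv hS.
have aT := psdmx_adj (pdmx_psdmx hT); have uT := pdmx_unit hT.
rewrite (gmeanE _ ST).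
apply: pdmx_congr_herm; [exact/psdmx_adj/pdmx_psdmx|exact: pdmx_unit|].
exact/pdmx_sqrtm/pdmx_congr_herm.
Qed.

(** With $S=X^{1/2}$ and $T=S^{-1}$, the inner matrices $TYT$ and $SY^{-1}S$ are mutually inverse,
    hence so are their square roots; the outer factors cancel. *)
Lemma gmean_inv X Y X' Y' : pdmx X -> pdmx Y ->
  X *m X' = 1%:M -> Y *m Y' = 1%:M -> gmean X Y *m gmean X' Y' = 1%:M.
Proof.
move=> hX hY XX' YY'; have hS := pdmx_sqrtm hX.
have ST := sqrtm_inv hX XX'; have TS := mulmx1C ST.
rewrite (gmeanE _ ST) (gmeanE _ TS).
move: ST TS; move: (sqrtm X') => T; move: hS; move: (sqrtm X) => S hS ST TS.
have uT : T \in unitmx by exact: mulmx1_unitl TS.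
have aT := inv_adj (psdmx_adj (pdmx_psdmx hS)) ST.
have hW : pdmx (T *m Y *m T) by apply: pdmx_congr_herm.
have hWW : (T *m Y *m T) *m (S *m Y' *m S) = 1%:M.
  by rewrite !mulmxA -(mulmxA _ T S) TS mulmx1 -(mulmxA T Y) YY' mulmx1.
have := sqrtm_inv hW hWW.
move: (sqrtm (T *m _ *m T)) (sqrtm (S *m _ *m S)) => Z Z' ZZ'.
by rewrite !mulmxA -(mulmxA _ S T) ST mulmx1 -(mulmxA S Z) ZZ' mulmx1.
Qed.

(** $vX'v^*-vY'v^*$ is the sum of $wXw^*$, where $w=vX'-vY'$, and of $vY'(Y-X)Y'v^*$, both
    nonnegative. *)
Lemma inv_anti X Y X' Y' : pdmx X -> pdmx Y -> X *m X' = 1%:M -> Y *m Y' = 1%:M ->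
  loewner X Y -> loewner Y' X'.
Proof.
move=> hX hY XX YY XY.
have aX := inv_adj (psdmx_adj (pdmx_psdmx hX)) XX.
have aY := inv_adj (psdmx_adj (pdmx_psdmx hY)) YY.
have XX2 := mulmx1C XX; have YY2 := mulmx1C YY.
apply: herm_psdmx; first by rewrite adjmxD adjmxN aX aY.
move=> v.
have h1 := psdmx_Re (v *m X' - v *m Y') (pdmx_psdmx hX).
have h2 := psdmx_Re (v *m Y') XY.
move: h1 h2; rewrite !(qfDm, qfNm, qfDl, qfDr, qfNl, qfNr).
rewrite !(qf_mull, qf_mulr) aX aY.
rewrite XX2 YY2 -(mulmxA Y' X X') XX !mulmx1 !mul1mx.
rewrite !(ReD, ReN); lra.
Qed.

End Sqrtm.
End Gmean.

(** * Positive two-by-two block matrices *)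

Section Block.
Variable R : realType.
Local Notation C := (R[i]).

Lemma Re_affine (a b : R) (z : C) :
  complex.Re (((a%:C)%C) * (z *+ 2) - (b%:C)%C) = a * (complex.Re z *+ 2) - b.
Proof. by case: z => x y; rewrite /= mul0r subr0. Qed.

(* Positivity of the 2 x 2 block matrix [[P, Z], [Z, Q]]. *)
Definition block_psd p (P Z Q : 'M[C]_p) : Prop :=
  forall u w : 'rV[C]_p, 0 <= qf P u u + qf Z u w + qf Z w u + qf Q w w.

Lemma block_psd_sum p I (r : seq I) (P Z Q : I -> 'M[C]_p) :
  (forall i, block_psd (P i) (Z i) (Q i)) ->
  block_psd (\sum_(i <- r) P i) (\sum_(i <- r) Z i) (\sum_(i <- r) Q i).
Proof.
move=> h; elim: r => [|i r IH] u w.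
  by rewrite !big_nil /qf !mulmx0 !mul0mx !mxE !addr0.
rewrite !big_cons !qfDm; move: (addr_ge0 (h i u w) (IH u w)).
by congr (_ <= _); ring.
Qed.

(** At $(u,w)$ the form of the block is the form of [A] at $u+cw$, [c] being real. *)
Lemma block_psd_scale p (A : 'M[C]_p) (c : R) : psdmx A ->
  block_psd A ((c%:C)%C *: A) (((c ^+ 2)%:C)%C *: A).
Proof.
move=> hA u w; have := hA (u + (c%:C)%C *: w); rewrite -/(qf _ _ _).
rewrite !(qfDl, qfDr, qfZl, qfZr, qfZm) conj_realC.
by congr (_ <= _); rewrite rmorphXn; ring.
Qed.

Lemma block_psd_le_mean p (P Z Q : 'M[C]_p) :
  block_psd P Z Q -> psdmx (P + Q - (Z + Z)).
Proof.
move=> h v; move: (h v (- v)); rewrite -/(qf _ _ _).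
by rewrite !(qfDm, qfNm, qfNl, qfNr); congr (_ <= _); ring.
Qed.

(* An eigenvector of [W - Z'] for a negative eigenvalue would violate
   [Z' ^ 2 <= W ^ 2]; here [Z'] and [W ^ 2] are the congruence transforms of [Z]
   and [Q] by the inverse square root of [P]. *)
Lemma block_psd_le_gmean p (P Z Q : 'M[C]_p) : pdmx P -> adjmx Z = Z ->
  block_psd P Z Q -> loewner Z (gmean P Q).
Proof.
move=> hP aZ PZQ; have hS := pdmx_sqrtm hP.
have [T [ST TS hT]] := pdmx_inv hS.
have aS := psdmx_adj (pdmx_psdmx hS); have aT := psdmx_adj (pdmx_psdmx hT).
have hQ : psdmx Q.
  move=> v; have := PZQ 0 v.
  by rewrite /qf /adjmx trmx0 map_mx0 !mul0mx !mulmx0 !mxE !add0r.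
have SS := sqrtmM (pdmx_psdmx hP).
rewrite (gmeanE _ ST); have hQ' := psdmx_congr_herm aT hQ.
have WW := sqrtmM hQ'; have hW := psdmx_sqrtm hQ'.
move: WW hW; move: (sqrtm (T *m Q *m T)) => W WW hW.
move: (sqrtm P) SS ST TS aS {hS} => S SS ST TS aS.
have aW := psdmx_adj hW.
pose Z' := T *m Z *m T.
have aZ' : adjmx Z' = Z' by rewrite /Z' !adjmxM aT aZ mulmxA.
suff hD : psdmx (W - Z').
  have := psdmx_congr_herm aS hD; rewrite mulmxBr mulmxBl /loewner.
  suff -> : S *m Z' *m S = Z by [].
  by rewrite /Z' !mulmxA ST mul1mx -(mulmxA _ T S) TS mulmx1.
have aD : adjmx (W - Z') = W - Z' by rewrite adjmxD adjmxN aW aZ'.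
have [U [d [uU eD]]] := spectral_decomp aD.
rewrite eD; apply: psdmx_congdiag => i; rewrite leNgt; apply/negP => di.
pose v := row i U.
have eZ : v *m Z' = v *m W - ((d i)%:C)%C *: v.
  by rewrite -(row_congdiag d i uU) -eD mulmxBr subKr.
have cT A x y : qf A (x *m T) (y *m T) = qf (T *m A *m T) x y.
  by rewrite -{4}aT qf_congr.
have TPT : T *m P *m T = 1%:M.
  by rewrite -SS !mulmxA TS mul1mx ST.
have cZ x y : qf Z' x y = qf 1%:M x (y *m Z').
  by rewrite qf_mulr aZ' mul1mx.
have cW x y : qf W x y = qf 1%:M x (y *m W).
  by rewrite qf_mulr aW mul1mx.
(* These vectors complete the square and leave $vW^2v^*-vZ'^2v^*\ge0$. With $vZ'=vW-d_iv$ this reads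
   $2d_i\,vWv^*-d_i^2\ge0$, impossible for $d_i<0\le vWv^*$. *)
have := PZQ (- (v *m Z' *m T)) (v *m T).
rewrite qfNl qfNr opprK qfNl qfNr !cT TPT -/Z' -WW.
have -> : qf Z' v (v *m Z') = qf 1%:M (v *m Z') (v *m Z').
  by rewrite [RHS]qf_mull mulmx1.
rewrite cZ -(qf_mull W) cW eZ.
rewrite !(qfDl, qfDr, qfNl, qfNr, qfZl, qfZr) conj_realC (row_unitary i uU) -cW.
rewrite [qf 1%:M (v *m W) v]qf_mull mulmx1 -!cW => h.
have {h}: 0 <= ((d i)%:C)%C * (qf W v v *+ 2) - ((d i * d i)%:C)%C.
  by move: h; congr (_ <= _); rewrite rmorphM; ring.
move=> /Re_ge0; rewrite Re_affine => h2.
have h1 := psdmx_Re v hW.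
have h3 : d i * complex.Re (qf W v v) <= 0 by apply: mulr_le0_ge0 => //; exact: ltW.
have h4 : 0 < d i * d i by rewrite nmulr_lgt0.
move: (complex.Re (qf W v v)) h2 h3 => x h2 h3; clear -h2 h3 h4; lra.
Qed.
End Block.

(** * Positive multilinear maps *)

Section Multilinear.
Variables (R : realType) (k n m : nat).
Local Notation C := (R[i]).
Variable Phi : ('I_k -> 'M[C]_n) -> 'M[C]_m.
Hypotheses (Phi_lin : multilinear Phi) (Phi_pos : positive_map Phi).
Implicit Types A B : 'I_k -> 'M[C]_n.

Lemma upd_id A i : upd A i (A i) = A.
Proof. by apply: funext => j; rewrite /upd; case: eqP => [->|]. Qed.

Lemma PhiD A i X Y : Phi (upd A i (X + Y)) = Phi (upd A i X) + Phi (upd A i Y).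
Proof. by rewrite -[X]scale1r Phi_lin !scale1r. Qed.

Lemma Phi0 A i : Phi (upd A i 0) = 0.
Proof.
by apply: (addrI (Phi (upd A i 0))); rewrite -PhiD !addr0.
Qed.

Lemma PhiZ A i c X : Phi (upd A i (c *: X)) = c *: Phi (upd A i X).
Proof. by rewrite -[c *: X]addr0 Phi_lin Phi0 addr0. Qed.

Lemma Phi_sum A i I (r : seq I) X :
  Phi (upd A i (\sum_(a <- r) X a)) = \sum_(a <- r) Phi (upd A i (X a)).
Proof.
elim: r => [|a r IH]; first by rewrite !big_nil Phi0.
by rewrite !big_cons PhiD IH.
Qed.

Lemma Phi_scale (c : 'I_k -> C) A :
  Phi (fun j => c j *: A j) = (\prod_j c j) *: Phi A.
Proof.
suff h (s : seq 'I_k) : uniq s -> Phi (fun j => if j \in s then c j *: A j else A j) =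
    (\prod_(j <- s) c j) *: Phi A.
  have := h _ (index_enum_uniq _); congr (_ = _); congr Phi.
  by apply: funext => j; rewrite mem_index_enum.
elim: s => [|i s IH] /=; first by rewrite big_nil scale1r.
case/andP=> is_ us; set B := fun j => if j \in s then c j *: A j else A j in IH.
have -> : (fun j => if j \in i :: s then c j *: A j else A j) =
    upd B i (c i *: A i).
  apply: funext => j; rewrite /upd inE; case: eqP => [->|] //=.
rewrite PhiZ big_cons -scalerA -IH // -{2}(upd_id B i) {3}/B.
by rewrite (negPf is_).
Qed.

(** Slots pass from [X] to [Y] one at a time; each passage adds the value of [Phi] at a tuple with
    $Y_i-X_i$ in slot [i] and semidefinite matrices elsewhere. *)
Lemma Phi_mono X Y : (forall j, psdmx (X j)) -> (forall j, loewner (X j) (Y j)) ->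
  loewner (Phi X) (Phi Y).
Proof.
move=> X0 XY.
have Y0 j : psdmx (Y j) by rewrite -(subrK (X j) (Y j)); apply: psdmxD; [exact: XY|].
suff h (s : seq 'I_k) : loewner (Phi X) (Phi (fun j => if j \in s then Y j else X j)).
  have := h (index_enum _); congr (loewner _ _); congr Phi.
  by apply: funext => j; rewrite mem_index_enum.
elim: s => [|i s IH]; first exact: loewnerxx.
apply: loewner_trans IH _; set Z := (fun j => if j \in s then _ else _).
have Z0 j : psdmx (Z j) by rewrite /Z; case: ifP.
have -> : (fun j => if j \in i :: s then Y j else X j) = upd Z i (Y i).
  by apply: funext => j; rewrite /upd /Z inE; case: eqP => [->|].
rewrite -(subrK (Z i) (Y i)) PhiD upd_id /loewner addrK.
apply: Phi_pos => j; rewrite /upd; case: eqP => // _.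
(* If [i] also occurs in [s], its slot is already changed and the increment is zero. *)
by rewrite /Z; case: ifP => _; [rewrite subrr; exact: psdmx0|exact: XY].
Qed.

(* [G] is the geometric mean of [X] and [Y], which need not be invertible. *)
Definition geo_triple (X Y G : 'M[C]_n) : Prop :=
  exists (V : 'M[C]_n) (d : 'I_n -> R),
  [/\ X = congdiag V (fun=> 1), Y = congdiag V (fun i => d i ^+ 2) & G = congdiag V d].

(** The state of a slot once it is reduced to a single term of its expansion. *)
Definition scaled_triple (X Y G : 'M[C]_n) : Prop :=
  psdmx X /\ exists c : R, Y = ((c ^+ 2)%:C)%C *: X /\ G = (c%:C)%C *: X.

(** Induction on the list of slots that may still need expanding; the tuples stay quantified, since
    every rank-one term yields new ones. *)
Lemma Phi_geo_triple X Y G : (forall j, geo_triple (X j) (Y j) (G j)) ->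
  block_psd (Phi X) (Phi G) (Phi Y).
Proof.
suff h (s : seq 'I_k) : forall X Y G,
    (forall j, scaled_triple (X j) (Y j) (G j) \/
               (j \in s /\ geo_triple (X j) (Y j) (G j))) ->
    block_psd (Phi X) (Phi G) (Phi Y).
  by move=> XYG; apply: (h (index_enum _)) => j; right; rewrite mem_index_enum.
elim: s => {X Y G} [|i s IH] X Y G XYG.
  have {}XYG j : scaled_triple (X j) (Y j) (G j) by case: (XYG j) => // -[].
  (* No slot is left: the coefficients collect into $c=\prod_jc_j$, and the block is that of
     [block_psd_scale] for [Phi X]. *)
  have [c cP] := fin_all_exists (fun j => proj2 (XYG j)).
  have -> : Y = fun j => ((c j ^+ 2)%:C)%C *: X j.
    by apply: funext => j; case: (cP j).
  have -> : G = fun j => ((c j)%:C)%C *: X j.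
    by apply: funext => j; case: (cP j).
  rewrite !Phi_scale -!rmorph_prod prodrXl.
  by apply/block_psd_scale/Phi_pos => j; case: (XYG j).
case: (XYG i) => [Si|[_ [V [d [eX eY eG]]]]].
  apply: IH => j; case: (XYG j) => [|[]]; first by left.
  by rewrite inE => /predU1P[->|]; [left|right].
(* The three matrices in slot [i] share the rows of [V], so the block splits into a sum of
   blocks. *)
rewrite -(upd_id X i) -(upd_id Y i) -(upd_id G i) eX eY eG !congdiagE !Phi_sum.
apply: block_psd_sum => a; apply: IH => j; rewrite /upd.
case: eqP => [_|ji].
  left; rewrite scale1r; split; first exact: psdmx_rank1.
  by exists (d a).
case: (XYG j) => [|[]]; first by left.
by rewrite inE => /predU1P[/ji|]; [|right].
Qed.

End Multilinear.

(** With $S=X^{1/2}$ and $S^{-1}YS^{-1}=U^*\mathrm{diag}(d)U$, the common congruence is $V=US$, and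
    the mean has diagonal $\sqrt{d_i}$. *)
Lemma gmean_geo_triple (R : realType) n (X Y : 'M[R[i]]_n) : pdmx X -> pdmx Y ->
  geo_triple X Y (gmean X Y).
Proof.
move=> hX hY; have hS := pdmx_sqrtm hX; have [T [ST TS hT]] := pdmx_inv hS.
have SS := sqrtmM (pdmx_psdmx hX).
have aS := psdmx_adj (pdmx_psdmx hS); have aT := psdmx_adj (pdmx_psdmx hT).
have [U [d [uU d0 eW]]] := psdmx_decomp (psdmx_congr_herm aT (pdmx_psdmx hY)).
rewrite (gmeanE _ ST) eW sqrtm_congdiag //.
have eY : sqrtm X *m congdiag U d *m sqrtm X = Y.
  rewrite -eW; move: (sqrtm X) ST TS => S ST TS.
  by rewrite !mulmxA ST mul1mx -(mulmxA Y) TS mulmx1.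
move: (sqrtm X) SS aS eY => S SS aS eY.
have cS e : congdiag (U *m S) e = S *m congdiag U e *m S.
  by rewrite /congdiag adjmxM aS !mulmxA.
exists (U *m S), (fun i => Num.sqrt (d i)); split.
- by rewrite congdiag1 adjmxM aS mulmxA -(mulmxA S) unitary_adjl // mulmx1.
- rewrite cS -[LHS]eY; congr (_ *m congdiag _ _ *m _).
  by apply: funext => i; rewrite sqr_sqrtr.
- by rewrite cS.
Qed.

(** * Convexity and bounds for real functions *)

Section RealLemmas.
Variable R : realType.

(** The upper bound takes the place of continuity: a positive excess over the chord would double
    indefinitely. *)
Lemma midconvex_bounded_convex (phi : R -> R) (K : R) :
  (forall s t, 0 <= s <= 1 -> 0 <= t <= 1 ->
     phi ((s + t) / 2) <= (phi s + phi t) / 2) ->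
  (forall t, 0 <= t <= 1 -> phi t <= K) ->
  forall t, 0 <= t <= 1 -> phi t <= (1 - t) * phi 0 + t * phi 1.
Proof.
move=> mid bd t0 ht0.
pose g t := phi t - ((1 - t) * phi 0 + t * phi 1).
pose K' := K + `|phi 0| + `|phi 1|.
(* The excess over the chord is at most half its value at [2 t] or [2 t - 1]. *)
have half t : 0 <= t <= 1 -> exists2 s, 0 <= s <= 1 & g t <= g s / 2.
  move=> ht; have [t2|t2] := lerP t 2^-1.
  - exists (2 * t); first lra.
    have := mid 0 (2 * t); have -> : (0 + 2 * t) / 2 = t by lra.
    by move=> /(_ ltac:(lra) ltac:(lra)); rewrite /g; lra.
  - exists (2 * t - 1); first lra.
    have := mid 1 (2 * t - 1); have -> : (1 + (2 * t - 1)) / 2 = t by lra.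
    by move=> /(_ ltac:(lra) ltac:(lra)); rewrite /g; lra.
(* Since $n+2\le2(n+1)$, doubling gives at least this linear growth, which suffices for the
   Archimedean contradiction. *)
have gK n : forall t, 0 <= t <= 1 -> g t *+ n.+1 <= K'.
  elim: n => [|n IH] t ht.
    have h0 := ler_norm (- phi 0); have h1 := ler_norm (- phi 1).
    have h2 := normr_ge0 (phi 0); have h3 := normr_ge0 (phi 1).
    rewrite !normrN in h0 h1.
    have h4 := bd t ht; rewrite mulr1n /g /K'.
    have h5 : (1 - t) * - phi 0 <= `|phi 0| by nra.
    have h6 : t * - phi 1 <= `|phi 1| by nra.
    lra.
  have [s hs gs] := half t ht.
  have [gt0|gt0] := lerP (g t) 0.
    apply: le_trans (IH t ht); rewrite mulrS; lra.
  apply: le_trans (IH s hs); rewrite -[_ *+ n.+2]mulr_natr -[_ *+ n.+1]mulr_natr.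
  have n0 : 0 <= (n%:R : R) by [].
  rewrite -!natr1; nra.
rewrite -subr_le0 -/(g t0) leNgt; apply/negP => g0.
have K0 : 0 <= K' / g t0.
  by rewrite divr_ge0 // ltW // (lt_le_trans g0) //; have := gK 0%N t0 ht0.
have := archi_boundP K0; set n := Num.bound _ => hn.
have := gK n t0 ht0; rewrite -mulr_natr -natr1.
move: hn; rewrite ltr_pdivrMr // => hn; lra.
Qed.

Lemma jensen_sum (h : R -> R) (I : Type) (r : seq I) (w x : I -> R) :
  (forall x y t : R, 0 <= x -> 0 <= y -> 0 <= t <= 1 ->
     h ((1 - t) * x + t * y) <= (1 - t) * h x + t * h y) ->
  (forall i, 0 <= w i) -> (forall i, 0 <= x i) -> \sum_(i <- r) w i = 1 ->
  h (\sum_(i <- r) w i * x i) <= \sum_(i <- r) w i * h (x i).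
Proof.
move=> cvx w0 x0 w1.
(* The mass [c] at [y] is an accumulator: the head of the list merges with it at their barycentre
   [z], so the total mass stays 1. *)
suff gen : forall c y : R, 0 <= c -> 0 <= y -> c + \sum_(i <- r) w i = 1 ->
    h (c * y + \sum_(i <- r) w i * x i) <= c * h y + \sum_(i <- r) w i * h (x i).
  have := gen 0 0; rewrite !mul0r !add0r; exact.
elim: r {w1} => [|i r IH] c y c0 y0.
  by rewrite !big_nil !addr0 => ->; rewrite !mul1r.
rewrite !big_cons !addrA => cw1.
have wi := w0 i; have xi := x0 i.
have [e|ne] := eqVneq (c + w i) 0.
  have [c00 w00] : c = 0 /\ w i = 0 by split; lra.
  by have := IH 0 y; rewrite c00 w00 !mul0r !add0r; apply=> //; lra.
have cwp : 0 < c + w i by rewrite lt_neqAle eq_sym ne addr_ge0.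
have [t t0 [et et1]] : exists2 t, 0 <= t <= 1 &
    (c + w i) * t = w i /\ (c + w i) * (1 - t) = c.
  have e : (c + w i) * (w i / (c + w i)) = w i by rewrite mulrC divfK.
  exists (w i / (c + w i)); last by rewrite mulrBr e mulr1 addrK.
  by rewrite divr_ge0 ?ler_pdivrMr ?mul1r ?lerDr // ltW.
have := cvx y (x i) t y0 xi t0; set z := (1 - t) * y + _ => hz.
have z0 : 0 <= z by rewrite /z addr_ge0 // mulr_ge0 //; lra.
have -> : c * y + w i * x i = (c + w i) * z.
  by rewrite /z mulrDr !mulrA et et1.
apply: le_trans (IH _ _ (ltW cwp) z0 cw1) _.
rewrite lerD2r.
have -> : c * h y + w i * h (x i) = (c + w i) * ((1 - t) * h y + t * h (x i)).
  by rewrite mulrDr !mulrA et et1.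
by rewrite ler_pM2l.
Qed.

Lemma pos_continuous_bounded (f : R -> R) (a b : R) : 0 < a ->
  (forall x, 0 < x -> {for x, continuous f}) ->
  exists K, forall x, a <= x <= b -> f x <= K.
Proof.
move=> a0 cf; have [ab|ba] := leP a b; last by exists 0 => x; lra.
have [|c _ hc] := @EVT_max R f a b ab.
  apply: continuous_in_subspaceT => x; rewrite inE /= in_itv /= => /andP[ax _].
  exact: cf (lt_le_trans a0 ax).
by exists (f c) => x hx; apply: hc; rewrite in_itv.
Qed.

Lemma fin_pos_bounds p (d : 'I_p -> R) : (forall i, 0 < d i) ->
  exists a b : R, 0 < a /\ forall i, a <= d i <= b.
Proof.
(* [M] dominates every $d_i$ and every $d_i^{-1}$; the summand 1 keeps it positive when [p] is 0. *)
move=> d0; pose M := 1 + \sum_i (d i + (d i)^-1).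
have pos i : 0 <= d i + (d i)^-1 by rewrite addr_ge0 ?invr_ge0 // ltW.
have M0 : 0 < M by rewrite ltr_wpDr // sumr_ge0.
exists M^-1, M; split; first by rewrite invr_gt0.
move=> i; have iM : d i + (d i)^-1 <= M.
  by rewrite /M (bigD1 i) //= addrCA lerDl addr_ge0 // sumr_ge0.
have id0 : 0 < (d i)^-1 by rewrite invr_gt0.
apply/andP; split; last by have := d0 i; lra.
by rewrite -[leRHS]invrK lef_pV2 ?posrE //; have := d0 i; lra.
Qed.

End RealLemmas.

(** * Operator log-convex functions and log-convexity of [F] *)

Section LogConvex.
Variable R : realType.
Local Notation C := (R[i]).

Lemma unitary1 p : unitary (1%:M : 'M[C]_p).
Proof. by rewrite /unitary adjmx1 mulmx1. Qed.

Lemma congdiag_const p (U : 'M[C]_p) (x : R) : unitary U ->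
  congdiag U (fun=> x) = ((x%:C)%C)%:M.
Proof.
move=> uU; rewrite /congdiag.
have -> : diag_mx (\row_(i < p) (x%:C)%C) = ((x%:C)%C)%:M.
  by apply/matrixP => i j; rewrite !mxE.
by rewrite -scalemx1 -scalemxAr mulmx1 -scalemxAl unitary_adjl // scalemx1.
Qed.

Lemma mxfun_scalar p (f : R -> R) (x : R) :
  mxfun f (((x%:C)%C)%:M : 'M[C]_p) = (((f x)%:C)%C)%:M.
Proof.
have u1 := unitary1 p.
by rewrite -(congdiag_const x u1) mxfun_congdiag ?congdiag_const.
Qed.

Lemma pdmx_scalar p (x : R) : 0 < x -> pdmx (((x%:C)%C)%:M : 'M[C]_p).
Proof.
move=> x0; have u1 := unitary1 p.
by rewrite -(congdiag_const x u1); apply: pdmx_congdiag.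
Qed.

Lemma half_realC : 2^-1 = ((2^-1 : R)%:C)%C :> C.
Proof. by rewrite fmorphV rmorph_nat. Qed.

Lemma pdmxZ p (c : R) (A : 'M[C]_p) : 0 < c -> pdmx A -> pdmx ((c%:C)%C *: A).
Proof.
move=> c0 hA v v0; rewrite -/(qf _ _ _) qfZm mulr_gt0 ?ltcR //; exact: hA.
Qed.

Lemma amean_pdmx p (A B : 'M[C]_p) : pdmx A -> pdmx B -> pdmx (amean A B).
Proof.
move=> hA hB; rewrite /amean half_realC; apply: pdmxZ; first by rewrite invr_gt0.
exact: pdmxD hA (pdmx_psdmx hB).
Qed.

(** Whatever [invmx] returns at the inner places, the outer factors [sqrtm 0] vanish. *)
Lemma gmean0 p (Y : 'M[C]_p) : gmean 0 Y = 0.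
Proof.
have s0 : sqrtm (0 : 'M[C]_p) = 0.
  have -> : (0 : 'M[C]_p) = (((0 : R)%:C)%C)%:M by rewrite raddf0.
  by rewrite /sqrtm mxfun_scalar sqrtr0.
by rewrite /gmean s0 mulmx0.
Qed.

Lemma op_log_convex_zero_step (f : R -> R) (x y : R) : op_log_convex f ->
  (forall x : R, 0 < x -> 0 <= f x) -> 0 < x -> 0 < y -> f x = 0 ->
  f ((x + y) / 2) = 0.
Proof.
move=> olc f0 x0 y0 fx0; apply/eqP; rewrite eq_le f0 ?andbT;
  last by rewrite divr_gt0 ?addr_gt0.
have := olc 1%N _ _ (pdmx_scalar x0) (pdmx_scalar y0).
rewrite !mxfun_scalar fx0 raddf0 gmean0.
have -> : amean (((x%:C)%C)%:M : 'M[C]_1) ((y%:C)%C)%:M = ((((x + y) / 2)%:C)%C)%:M.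
  rewrite /amean half_realC -raddfD /= scale_scalar_mx.
  by rewrite -rmorphD -rmorphM mulrC.
rewrite mxfun_scalar => /(_ (delta_mx 0 0)).
rewrite -/(qf _ _ _) qf_delta sub0r !mxE eqxx mulr1n => /Re_ge0.
by rewrite ReN ReC oppr_ge0.
Qed.

(** A zero at [u] forces zeros at all $v>u/2$, since [v] is the midpoint of [u] and the positive
    point $2v-u$. Repeating this reaches every positive point. *)
Lemma op_log_convex_dichotomy (f : R -> R) : op_log_convex f ->
  (forall x : R, 0 < x -> 0 <= f x) ->
  (forall x : R, 0 < x -> f x = 0) \/ (forall x : R, 0 < x -> 0 < f x).
Proof.
move=> olc f0; have [[x [x0 fx]]|nz] := pselect (exists x, 0 < x /\ f x = 0); last first.
  right=> x x0; rewrite lt_neqAle f0 // andbT; apply/eqP => fx; apply: nz.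
  by exists x.
left=> y y0.
have step u v : 0 < u -> f u = 0 -> u < 2 * v -> f v = 0.
  move=> u0 fu uv; have -> : v = (u + (2 * v - u)) / 2 by lra.
  by apply: op_log_convex_zero_step => //; rewrite subr_gt0.
(* While $u>y$ the zero can move down by $y/2$, because $u-y/2>u/2$; [n] bounds the number of
   moves. *)
suff h n : forall u, 0 < u -> f u = 0 -> u < y + n%:R * (y / 2) -> f y = 0.
  have b0 : 0 <= x / (y / 2) by rewrite divr_ge0 ?divr_ge0 // ltW.
  apply: (h (Num.bound (x / (y / 2))) x) => //.
  have := archi_boundP b0; rewrite ltr_pdivrMr ?divr_gt0 // => hb.
  by rewrite ltr_wpDl // ltW.
elim: n => [|n IH] u u0 fu.
  by rewrite mul0r addr0 => uy; apply: (step u) => //; lra.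
have [uy|yu] := lerP u y; first by move=> _; apply: (step u) => //; lra.
rewrite -natr1 => hu; apply: (IH (u - y / 2)); [lra| |lra].
by apply: (step u) => //; lra.
Qed.

Lemma mxfun_ext_pos p (f g : R -> R) (A : 'M[C]_p) : pdmx A ->
  (forall x : R, 0 < x -> f x = g x) -> mxfun f A = mxfun g A.
Proof.
move=> /pdmx_decomp[U [d [uU d0 ->]]] fg; rewrite !mxfun_congdiag //.
by congr congdiag; apply: funext => i; apply: fg.
Qed.

Lemma mxfun_psdmx p (f : R -> R) (A : 'M[C]_p) : pdmx A ->
  (forall x : R, 0 < x -> 0 <= f x) -> psdmx (mxfun f A).
Proof.
move=> /pdmx_decomp[U [d [uU d0 ->]]] f0; rewrite mxfun_congdiag //.
by apply: psdmx_congdiag => i; apply: f0.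
Qed.

Lemma mxfun_pdmx p (f : R -> R) (A : 'M[C]_p) : pdmx A ->
  (forall x : R, 0 < x -> 0 < f x) -> pdmx (mxfun f A).
Proof.
move=> /pdmx_decomp[U [d [uU d0 ->]]] f0; rewrite mxfun_congdiag //.
by apply: pdmx_congdiag => // i; apply: f0.
Qed.

(** An identically zero function gives zero matrices, whose triple has [V = 0]; a positive one gives
    definite matrices, and [G] is their geometric mean. *)
Lemma op_log_convex_geo_triple p (f : R -> R) (A B : 'M[C]_p) : op_log_convex f ->
  (forall x : R, 0 < x -> 0 <= f x) -> pdmx A -> pdmx B ->
  exists G, geo_triple (mxfun f A) (mxfun f B) G /\
            loewner (mxfun f (amean A B)) G.
Proof.
move=> olc f0 hA hB; have [fz|fp] := op_log_convex_dichotomy olc f0.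
  have z X : pdmx X -> mxfun f X = 0.
    move=> hX; rewrite (mxfun_ext_pos (g := fun=> 0) hX fz).
    have [U [d [uU _ ->]]] := pdmx_decomp hX.
    by rewrite mxfun_congdiag // congdiag_const // raddf0.
  have c0 d : congdiag (0 : 'M[C]_p) d = 0 by rewrite /congdiag mulmx0.
  exists 0; split; last by rewrite z; [exact: loewnerxx|exact: amean_pdmx].
  by exists 0, (fun=> 0); rewrite !c0 !z.
exists (gmean (mxfun f A) (mxfun f B)); split; last exact: olc.
by apply: gmean_geo_triple; apply: mxfun_pdmx.
Qed.

Section Map.
Variables (k n m : nat).
Variable Phi : ('I_k -> 'M[C]_n) -> 'M[C]_m.
Hypotheses (Phi_lin : multilinear Phi) (Phi_pos : positive_map Phi).
Variable f : 'I_k -> R -> R.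
Hypothesis f0 : forall j x, 0 < x -> 0 <= f j x.
Hypothesis folc : forall j, op_log_convex (f j).
Implicit Types A B : 'I_k -> 'M[C]_n.

Let F A := Phi (fun j => mxfun (f j) (A j)).

Lemma F_psdmx A : (forall j, pdmx (A j)) -> psdmx (F A).
Proof. by move=> hA; apply: Phi_pos => j; apply: mxfun_psdmx (hA j) (f0 j). Qed.

(** Common source of (i) and (iii): [Phi] applied to slotwise means. The result is Hermitian because
    it dominates a semidefinite matrix. *)
Lemma F_amean_block A B : (forall j, pdmx (A j)) -> (forall j, pdmx (B j)) ->
  exists G, [/\ adjmx G = G, block_psd (F A) G (F B) &
                loewner (F (fun j => amean (A j) (B j))) G].
Proof.
move=> hA hB.
have [G hG] := fin_all_exists (fun j =>
  op_log_convex_geo_triple (@folc j) (@f0 j) (hA j) (hB j)).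
have hAB j : pdmx (amean (A j) (B j)) by apply: amean_pdmx.
have le : loewner (F (fun j => amean (A j) (B j))) (Phi G).
  apply: Phi_mono => // j; first exact: mxfun_psdmx (hAB j) (f0 j).
  by case: (hG j).
exists (Phi G); split; last exact: le.
  apply: psdmx_adj; rewrite -(subrK (F (fun j => amean (A j) (B j))) (Phi G)).
  exact: psdmxD le (F_psdmx hAB).
exact: (Phi_geo_triple Phi_lin Phi_pos (fun j => proj1 (hG j))).
Qed.

Lemma F_log_convex A B : (forall j, pdmx (A j)) -> (forall j, pdmx (B j)) ->
  pdmx (F A) -> loewner (F (fun j => amean (A j) (B j))) (gmean (F A) (F B)).
Proof.
move=> hA hB FA; have [G [aG bG leG]] := F_amean_block hA hB.
by apply: loewner_trans leG _; apply: block_psd_le_gmean.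
Qed.

Lemma F_mid_convex A B : (forall j, pdmx (A j)) -> (forall j, pdmx (B j)) ->
  psdmx (F A + F B - (F (fun j => amean (A j) (B j))
                      + F (fun j => amean (A j) (B j)))).
Proof.
move=> hA hB; have [G [aG bG leG]] := F_amean_block hA hB.
have := psdmxD (block_psd_le_mean bG) (psdmxD leG leG).
by congr psdmx; rewrite [(G - _) + _]addrACA -opprD subrKA.
Qed.

End Map.
End LogConvex.

(** * Jensen's inequality for quadratic forms and convexity of traces *)

Section TraceConvex.
Variable R : realType.
Local Notation C := (R[i]).

Lemma Re_comb (a b : R) (x y : C) : complex.Re ((a%:C)%C * x + (b%:C)%C * y) =
  a * complex.Re x + b * complex.Re y.
Proof. by case: x y => [? ?] [? ?]; rewrite /= !mul0r !subr0. Qed.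

Lemma Re_qfD p (P Q : 'M[C]_p) v :
  complex.Re (qf (P + Q) v v) = complex.Re (qf P v v) + complex.Re (qf Q v v).
Proof. by rewrite qfDm; exact: ReD. Qed.

Lemma Re_qfB p (P Q : 'M[C]_p) v :
  complex.Re (qf (P - Q) v v) = complex.Re (qf P v v) - complex.Re (qf Q v v).
Proof. by rewrite Re_qfD qfNm; congr (_ + _); exact: ReN. Qed.

Lemma loewner_Re p (P Q : 'M[C]_p) v : loewner P Q ->
  complex.Re (qf P v v) <= complex.Re (qf Q v v).
Proof. by move=> /(psdmx_Re v); rewrite Re_qfB subr_ge0. Qed.

Lemma psdmx_mean_Re p (P Q H : 'M[C]_p) v : psdmx (P + Q - (H + H)) ->
  complex.Re (qf H v v) <= (complex.Re (qf P v v) + complex.Re (qf Q v v)) / 2.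
Proof. by move=> /loewner_Re => /(_ v); rewrite !Re_qfD; lra. Qed.

(** The weights are the squared moduli of the coordinates of [u] in the eigenbasis. Being
    independent of [d], they serve a matrix and any function of it alike. *)
Lemma unit_qf_weights p (U : 'M[C]_p) (u : 'rV[C]_p) : unitary U ->
  qf 1%:M u u = 1 ->
  exists w : 'I_p -> R, [/\ forall i, 0 <= w i, \sum_i w i = 1 &
    forall d, qf (congdiag U d) u u = ((\sum_i w i * d i)%:C)%C].
Proof.
move=> uU u1.
pose w i := complex.Re (`|(u *m adjmx U) 0 i| ^+ 2).
have we i : `|(u *m adjmx U) 0 i| ^+ 2 = ((w i)%:C)%C.
  by apply/ReK/CrealP; rewrite rpredX // normr_real.
have wd d : qf (congdiag U d) u u = ((\sum_i w i * d i)%:C)%C.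
  rewrite qf_congdiag rmorph_sum; apply: eq_bigr => i _.
  by rewrite we rmorphM mulrC.
exists w; split=> //.
  by move=> i; apply: Re_ge0; apply: exprn_ge0.
have := wd (fun=> 1); rewrite congdiag1 unitary_adjl // u1 => /(congr1 (@complex.Re R)).
by rewrite ReC => /esym; under eq_bigr do rewrite mulr1.
Qed.

Lemma unit_qf_bounds p (A : 'M[C]_p) : pdmx A ->
  exists a b : R, 0 < a /\ forall u : 'rV[C]_p, qf 1%:M u u = 1 ->
    a <= complex.Re (qf A u u) <= b.
Proof.
move=> /pdmx_decomp[U [d [uU d0 ->]]].
have [a [b [a0 ab]]] := fin_pos_bounds d0.
exists a, b; split=> // u u1; have [w [w0 w1 ->]] := unit_qf_weights uU u1.
rewrite ReC -[a]mul1r -[b]mul1r -w1 !mulr_suml.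
by apply/andP; split; apply: ler_sum => i _; apply: ler_wpM2l => //; case/andP: (ab i).
Qed.

(** With the weights of [unit_qf_weights] this is scalar Jensen for the eigenvalues of [P]. *)
Lemma jensen_qf p (h : R -> R) (P : 'M[C]_p) (u : 'rV[C]_p) :
  (forall x y t : R, 0 <= x -> 0 <= y -> 0 <= t <= 1 ->
     h ((1 - t) * x + t * y) <= (1 - t) * h x + t * h y) ->
  psdmx P -> qf 1%:M u u = 1 ->
  ((h (complex.Re (qf P u u)))%:C)%C <= qf (mxfun h P) u u.
Proof.
move=> cvx /psdmx_decomp[U [d [uU d0 ->]]] u1.
have [w [w0 w1 wd]] := unit_qf_weights uU u1.
by rewrite mxfun_congdiag // !wd ReC lecR; apply: jensen_sum.
Qed.

Lemma trace_unitary p (U X : 'M[C]_p) : unitary U ->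
  \tr X = \sum_i qf X (row i U) (row i U).
Proof.
move=> uU; rewrite -[X in LHS]mulmx1 -(unitary_adjl uU) mulmxA mxtrace_mulC mulmxA.
apply: eq_bigr => i _; rewrite -[LHS]qf_delta qf_congr.
by rewrite -rowE.
Qed.

Lemma trace_mxfun_congdiag p (U : 'M[C]_p) d h : unitary U ->
  \tr (mxfun h (congdiag U d)) = \sum_i ((h (d i))%:C)%C.
Proof.
move=> uU; rewrite mxfun_congdiag // (trace_unitary _ uU).
by apply: eq_bigr => i _; rewrite qf_row_congdiag.
Qed.

(* In an eigenbasis [u_i] of [T], monotonicity and convexity of [h] are applied to
   the diagonal entries of [T], [P], [Q]; Jensen's inequality bounds [h] of a
   diagonal entry of [P] by the diagonal entry of [h(P)] (Peierls). *)
Lemma trace_mxfun_convex p (h : R -> R) (T P Q : 'M[C]_p) (t : R) :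
  (forall x y t : R, 0 <= x -> 0 <= y -> 0 <= t <= 1 ->
     h ((1 - t) * x + t * y) <= (1 - t) * h x + t * h y) ->
  (forall x y : R, 0 <= x -> x <= y -> h x <= h y) ->
  0 <= t <= 1 -> psdmx T -> psdmx P -> psdmx Q ->
  (forall v, complex.Re (qf T v v) <=
     (1 - t) * complex.Re (qf P v v) + t * complex.Re (qf Q v v)) ->
  \tr (mxfun h T) <=
    ((1 - t)%:C)%C * \tr (mxfun h P) + (t%:C)%C * \tr (mxfun h Q).
Proof.
move=> cvx mono ht hT hP hQ TPQ.
have [U [d [uU d0 eT]]] := psdmx_decomp hT.
rewrite {1}eT trace_mxfun_congdiag // (trace_unitary (mxfun h P) uU).
rewrite (trace_unitary (mxfun h Q) uU) !mulr_sumr -big_split /=.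
apply: ler_sum => i _; set u := row i U.
have u1 : qf 1%:M u u = 1 by apply: row_unitary.
have jP := jensen_qf cvx hP u1; have jQ := jensen_qf cvx hQ u1.
have di : d i = complex.Re (qf T u u) by rewrite eT qf_row_congdiag.
have t0 : 0 <= t by lra.
have t1 : 0 <= 1 - t by lra.
have le : h (d i) <= (1 - t) * h (complex.Re (qf P u u)) + t * h (complex.Re (qf Q u u)).
  apply: le_trans (cvx _ _ _ (psdmx_Re u hP) (psdmx_Re u hQ) ht).
  by apply: mono => //; rewrite di.
move: le; rewrite -lecR => /le_trans; apply.
rewrite rmorphD !rmorphM.
by apply: (lerD (ler_wpM2l _ jP) (ler_wpM2l _ jQ)); rewrite ler0c.
Qed.

(** * Convexity of [F] along segments *)

Section Map.
Variables (k n m : nat).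
Variable Phi : ('I_k -> 'M[C]_n) -> 'M[C]_m.
Hypotheses (Phi_lin : multilinear Phi) (Phi_pos : positive_map Phi).
Variable f : 'I_k -> R -> R.
Hypothesis f0 : forall j x, 0 < x -> 0 <= f j x.
Hypothesis fcont : forall j x, 0 < x -> {for x, continuous (f j)}.
Hypothesis folc : forall j, op_log_convex (f j).
Variables A B : 'I_k -> 'M[C]_n.
Hypotheses (hA : forall j, pdmx (A j)) (hB : forall j, pdmx (B j)).

Let F A := Phi (fun j => mxfun (f j) (A j)).
Let seg (t : R) j := ((1 - t)%:C)%C *: A j + (t%:C)%C *: B j.

Lemma seg_pdmx t j : 0 <= t <= 1 -> pdmx (seg t j).
Proof.
(* At $t=1$ the [A] term vanishes and definiteness has to come from [B]. *)
move=> ht; have [t1|t1] := ltrP t 1.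
  by apply: pdmxD; [apply: pdmxZ => //; lra|apply: psdmxZ; [lra|exact: pdmx_psdmx]].
have -> : t = 1 by lra.
rewrite /seg subrr scale0r add0r; apply: pdmxZ => //; exact: ltr01.
Qed.

Lemma seg_amean s t j : amean (seg s j) (seg t j) = seg ((s + t) / 2) j.
Proof.
rewrite /amean /seg half_realC addrACA -!scalerDl scalerDr !scalerA.
rewrite -!rmorphD -!rmorphM.
by congr ((_%:C)%C *: _ + (_%:C)%C *: _); field.
Qed.

(** All eigenvalues along the segment lie in one compact interval of $(0,\infty)$, where the
    continuous [f j] is bounded above. *)
Lemma mxfun_seg_bounded j : exists K : R, forall t, 0 <= t <= 1 ->
  loewner (mxfun (f j) (seg t j)) ((K%:C)%C)%:M.
Proof.
have [a [b [a0 ab]]] := unit_qf_bounds (hA j).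
have [a' [b' [a'0 ab']]] := unit_qf_bounds (hB j).
have m0 : 0 < Num.min a a' by rewrite lt_min a0.
have [K hK] := pos_continuous_bounded (Num.max b b') m0 (@fcont j).
exists K => t ht; have [U [d [uU d0 e]]] := pdmx_decomp (seg_pdmx j ht).
rewrite e mxfun_congdiag // -(congdiag_const K uU).
have -> : loewner (congdiag U (f j \o d)) (congdiag U (fun=> K)) =
          psdmx (congdiag U (fun i => K - f j (d i))).
  congr psdmx; rewrite /congdiag -mulmxBl -mulmxBr -raddfB; congr (_ *m diag_mx _ *m _).
  by apply/rowP => i; rewrite !mxE rmorphB.
apply: psdmx_congdiag => i; rewrite subr_ge0; apply: hK.
have u1 := row_unitary i uU; move: (ab _ u1) (ab' _ u1).
have -> : d i = (1 - t) * complex.Re (qf (A j) (row i U) (row i U)) +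
    t * complex.Re (qf (B j) (row i U) (row i U)).
  have := congr1 (@complex.Re R) (qf_row_congdiag d i uU).
  by rewrite -e /seg qfDm !qfZm => /esym h; apply: etrans h (Re_comb _ _ _ _).
move: (complex.Re (qf (A j) _ _)) (complex.Re (qf (B j) _ _))
  => x y /andP[ax xb] /andP[ay yb].
have {}ax : Num.min a a' <= x by rewrite ge_min ax.
have {}ay : Num.min a a' <= y by rewrite ge_min ay orbT.
have {}xb : x <= Num.max b b' by rewrite le_max xb.
have {}yb : y <= Num.max b b' by rewrite le_max yb orbT.
move: (Num.min a a') (Num.max b b') ax ay xb yb => r s ax ay xb yb.
by apply/andP; split; nra.
Qed.

(** For fixed [v] the form is midpoint convex in [t] by [F_mid_convex]; monotonicity of [Phi] bounds
    it by the value at the scalar matrices [K j]. *)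
Lemma F_convex t v : 0 <= t <= 1 ->
  complex.Re (qf (F (seg t)) v v) <=
    (1 - t) * complex.Re (qf (F A) v v) + t * complex.Re (qf (F B) v v).
Proof.
have [K hK] := fin_all_exists mxfun_seg_bounded.
have e0 : seg 0 = A.
  by apply: funext => j; rewrite /seg subr0 scale1r scale0r addr0.
have e1 : seg 1 = B.
  by apply: funext => j; rewrite /seg subrr scale1r scale0r add0r.
suff: 0 <= t <= 1 -> complex.Re (qf (F (seg t)) v v) <=
    (1 - t) * complex.Re (qf (F (seg 0)) v v) + t * complex.Re (qf (F (seg 1)) v v).
  by rewrite e0 e1.
apply: (@midconvex_bounded_convex _ (fun t => complex.Re (qf (F (seg t)) v v))
  (complex.Re (qf (Phi (fun j => ((K j)%:C)%C%:M)) v v))).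
  move=> s r hs hr.
  apply: psdmx_mean_Re.
  have -> : seg ((s + r) / 2) = fun j => amean (seg s j) (seg r j).
    by apply: funext => j; rewrite seg_amean.
  by apply: (F_mid_convex Phi_lin Phi_pos f0 folc) => j; exact: seg_pdmx.
move=> s hs.
apply: loewner_Re; apply: (Phi_mono Phi_lin Phi_pos) => j; last exact: hK.
exact: mxfun_psdmx (seg_pdmx j hs) (@f0 j).
Qed.

End Map.
End TraceConvex.

(** [F] may take singular matrices as values, so invertibility is assumed where an inverse occurs,
    explicitly or inside [gmean]. In (iii), [h] is constrained on $[0,\infty)$, which contains the
    spectra of the values of [F]. *)
Theorem theorem3p11 (R : realType) (n m k : nat)
  (Phi : ('I_k -> 'M[R[i]]_n) -> 'M[R[i]]_m) (f : 'I_k -> R -> R) :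
  multilinear Phi -> positive_map Phi ->
  (forall j x, 0 < x -> 0 <= f j x) ->
  (forall j x, 0 < x -> {for x, continuous (f j)}) ->
  (forall j, op_log_convex (f j)) ->
  let F := fun A : 'I_k -> 'M[R[i]]_n => Phi (fun j => mxfun (f j) (A j)) in
  (* (i) joint log-convexity *)
  (forall A B : 'I_k -> 'M[R[i]]_n,
     (forall j, pdmx (A j)) -> (forall j, pdmx (B j)) ->
     F A \in unitmx ->
     loewner (F (fun j => amean (A j) (B j))) (gmean (F A) (F B)))
  /\
  (* (ii) joint log-concavity of the inverse *)
  (forall A B : 'I_k -> 'M[R[i]]_n,
     (forall j, pdmx (A j)) -> (forall j, pdmx (B j)) ->
     F A \in unitmx -> F B \in unitmx ->
     F (fun j => amean (A j) (B j)) \in unitmx ->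
     loewner (gmean (invmx (F A)) (invmx (F B)))
             (invmx (F (fun j => amean (A j) (B j)))))
  /\
  (* (iii) joint convexity of Tr h(F) for convex increasing h *)
  (forall h : R -> R,
     (forall x y t : R, 0 <= x -> 0 <= y -> 0 <= t <= 1 ->
        h ((1 - t) * x + t * y) <= (1 - t) * h x + t * h y) ->
     (forall x y : R, 0 <= x -> x <= y -> h x <= h y) ->
     forall (A B : 'I_k -> 'M[R[i]]_n) (t : R),
       (forall j, pdmx (A j)) -> (forall j, pdmx (B j)) -> 0 <= t <= 1 ->
       \tr (mxfun h (F (fun j => ((1 - t)%:C)%C *: A j + (t%:C)%C *: B j)))
       <= ((1 - t)%:C)%C * \tr (mxfun h (F A)) + (t%:C)%C * \tr (mxfun h (F B))).
Proof.
move=> Phi_lin Phi_pos f0 fcont folc F.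
have Fpsd A : (forall j, pdmx (A j)) -> psdmx (F A) by move=> hA; apply: F_psdmx.
split; [|split].
- move=> A B hA hB uA; apply: (F_log_convex Phi_lin Phi_pos f0 folc hA hB).
  exact: psdmx_unit_pdmx (Fpsd _ hA) uA.
- move=> A B hA hB uA uB uH.
  have pA := psdmx_unit_pdmx (Fpsd _ hA) uA.
  have pB := psdmx_unit_pdmx (Fpsd _ hB) uB.
  have pH := psdmx_unit_pdmx (Fpsd _ (fun j => amean_pdmx (hA j) (hB j))) uH.
  (* The mean of the inverses is the inverse of the mean, so inverting both sides of (i) gives the
     claim. *)
  apply: (inv_anti pH (gmean_pdmx pA pB)).
  + exact: mulmxV.
  + exact: (gmean_inv pA pB (mulmxV uA) (mulmxV uB)).
  + exact: (F_log_convex Phi_lin Phi_pos f0 folc hA hB pA).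
- move=> h hcvx hmono A B t hA hB ht.
  have hS := Fpsd _ (fun j => seg_pdmx hA hB j ht).
  apply: (trace_mxfun_convex hcvx hmono ht hS (Fpsd _ hA) (Fpsd _ hB)) => v.
  exact: (F_convex Phi_lin Phi_pos f0 fcont folc hA hB).
Qed.
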